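(* Let $(X,\mathcal{B},\mu)$ be a probability Lebesgue space, let $d$ be a metric on $X$ such that the support $\operatorname{supp}\mu$ is not reduced to a single point, and let $T:X\to X$ be an endomorphism of $(X,\mathcal{B},\mu)$. Assume that $T$ is ergodic and consider a finite measurable partition $\alpha=\{P_1,\dots,P_l\}$ of $X$. If $P_1,\dots,P_l$ are $\mu$-continuity sets for $d$ and if $h(T,\alpha)>0$, then $T$ is symmetrically sensitive.
   Context: An endomorphism $T$ of $(X,\mathcal{B},\mu)$ is a measurable map $T:X\to X$ preserving $\mu$, i.e. $\mu(T^{-1}A)=\mu(A)$ for all $A\in\mathcal{B}$. $\mu^{\otimes 2}=\mu\otimes\mu$ is the product measure on $X^2$ (understood as completed), and $\operatorname{supp}\mu$ is the topological support of $\mu$ for the metric $d$: the set of points all of whose open $d$-balls have positive measure. The metric is compatible with the measure structure: $\mathcal{B}$ contains the Borel sets of $(X,d)$ and $\mu(\operatorname{supp}\mu)=1$. A set $P\in\mathcal{B}$ is a $\mu$-continuity set for $d$ if its topological boundary in $(X,d)$ has $\mu$-measure zero. $h(T,\alpha)$ is the metric (Kolmogorov–Sinai) entropy of $T$ with respect to the partition $\alpha$. $T$ is symmetrically sensitive if there exists $\delta>0$ such that for $\mu^{\otimes 2}$-a.e. $(x,y)\in X^2$ one can find $n\ge 0$ with $d(T^n x,T^n y)\ge\delta$. *)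

(* Defs.v *)
From HB Require Import structures.
From mathcomp Require Import all_boot all_order all_algebra.
From mathcomp Require Import all_classical all_reals all_analysis.
From mathcomp Require Import measurable_realfun.

Set Implicit Arguments.
Unset Strict Implicit.
Unset Printing Implicit Defensive.

Import Order.TTheory GRing.Theory Num.Theory.
Import numFieldNormedType.Exports.

Local Open Scope classical_set_scope.
Local Open Scope ring_scope.

(* A carrier with a sigma-algebra and a metric, a priori unrelated. *)
#[short(type="measurableMetricType")]
HB.structure Definition MeasurableMetric (d : measure_display) (R : realType) :=
  { X of Measurable d X & Metric R X }.

Section lebesgue_space.
Local Open Scope ereal_scope.

(* Lebesgue measure on `[0, s] plus countably many atoms, realised on the real
   line by putting the k-th atom, of mass p k, at the point - (k + 1). Masses
   p k = 0 are allowed, which covers finitely many (or no) atoms. *)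
Definition interval_atoms (R : realType) (s : R) (p : nat -> R)
    (A : set (measurableTypeR R)) : \bar R :=
  lebesgue_measure (A `&` `[0%R, s]) +
  \sum_(0 <= k <oo) (p k)%:E * \d_((- k.+1%:R)%R : measurableTypeR R) A.

(* Rokhlin's definition: mu is complete and isomorphic mod 0 to an interval
   with atoms. The model carries the completion of its Borel sigma-algebra,
   completed_algebra_gen; since the completed measure is determined by its
   values on Borel sets, f preserves measure as soon as it does so for those. *)
Definition lebesgue_space d (X : measurableType d) (R : realType)
    (mu : probability X R) : Prop :=
  measure_is_complete mu /\
  exists (s : R) (p : nat -> R),
    [/\ (0 <= s)%R, forall k, (0 <= p k)%R &
     exists (M : set X) (N : set (measurableTypeR R)) (f : X -> measurableTypeR R),
      [/\ mu.-negligible (~` M), (interval_atoms s p).-negligible (~` N),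
          set_bij M N f,
          forall A, A `<=` M ->
            (measurable A <-> completed_algebra_gen (interval_atoms s p) (f @` A)) &
          forall B, measurable B -> mu (M `&` f @^-1` B) = interval_atoms s p B]].

End lebesgue_space.

Section endomorphisms.
Context d (X : measurableType d) (R : realType) (mu : probability X R).
Implicit Types (T : X -> X).

Definition endomorphism T : Prop :=
  measurable_fun setT T /\
  forall A, measurable A -> mu (T @^-1` A) = mu A.

Definition ergodic T : Prop :=
  forall A, measurable A -> T @^-1` A = A -> mu A = 0%E \/ mu A = 1%E.

(* Empty cells are allowed. *)
Definition measurable_partition (I : finType) (P : I -> set X) : Prop :=
  [/\ forall i, measurable (P i), trivIset setT P & cover setT P = setT].

(* The convention 0 * ln 0 = 0 holds automatically. *)
Definition partition_entropy (I : finType) (P : I -> set X) : R :=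
  - \sum_i fine (mu (P i)) * ln (fine (mu (P i))).

(* The join of P, T^-1 P, ..., T^-(n-1) P, with cells indexed by n-letter
   words; words that do not occur give empty cells, of zero contribution. *)
Definition iterated_join T (I : finType) (P : I -> set X) (n : nat)
    (w : {ffun 'I_n -> I}) : set X :=
  \bigcap_(k in [set: 'I_n]) (iter k T @^-1` P (w k)).

Definition ks_entropy T (I : finType) (P : I -> set X) : R :=
  limn (fun n : nat => partition_entropy (@iterated_join T I P n) / n%:R : R).

End endomorphisms.

Section metric_measure.
Context d (R : realType) (X : measurableMetricType d R) (mu : probability X R).

Definition support_of : set X :=
  [set x | forall e : R, 0 < e -> (0 < mu (ball x e))%E].

Definition continuity_set (P : set X) : Prop :=
  measurable P /\ mu (closure P `\` P°) = 0%E.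

(* {ae _} asks for the exceptional set to lie in a product-measurable null set,
   that is, to be null for the completed product measure. *)
Definition symmetrically_sensitive (T : X -> X) : Prop :=
  exists2 delta : R, 0 < delta &
    {ae (mu \x mu)%E, forall z : X * X,
      exists n : nat, delta <= mdist (iter n T z.1) (iter n T z.2)}.

End metric_measure.

(* Main.v *)
(** If T is not symmetrically sensitive then, for every r > 0, the pairs whose
    orbits stay r-close forever form a set of positive product measure.  The
    measure of its section at x does not decrease along the orbit of x, so by
    ergodicity it is at least some c > 0 for almost every x; hence at most 1 / c
    points x_i suffice for almost every orbit to shadow forever the orbit of
    some x_i.  As the cells are continuity sets, shadowing forces equality of
    letters except at visits to a set B of small measure.  Gibbs' inequality
    against the uniform mixture of the x_i-itineraries, each sent through a
    memoryless noisy channel, then bounds the entropy of the n-th join by a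
    constant plus n times a quantity that is as small as one likes, so that the
    entropy vanishes. *)
Require Import Defs.
From mathcomp Require Import all_boot all_order all_algebra.
From mathcomp Require Import all_classical all_reals all_analysis.
From mathcomp Require Import measurable_realfun lra.

Set Implicit Arguments.
Unset Strict Implicit.
Unset Printing Implicit Defensive.

Import Order.TTheory GRing.Theory Num.Theory.
Import numFieldNormedType.Exports.
Local Open Scope classical_set_scope.
Local Open Scope ring_scope.

(** * Gibbs' inequality and the code distribution *)

(** Sum [ln t <= t - 1] at [t = q i / p i] with weights [p i]. *)
Lemma gibbs_inequality (R : realType) (I : finType) (p q : I -> R) :
  (forall i, 0 <= p i) -> (forall i, 0 < q i) ->
  \sum_i p i = 1 -> \sum_i q i <= 1 ->
  - \sum_i p i * ln (p i) <= \sum_i p i * - ln (q i).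
Proof.
move=> p0 q0 p1 q1.
have term i : p i * ln (q i) - p i * ln (p i) <= q i - p i.
  have [->|pi0] := eqVneq (p i) 0; first by rewrite !mul0r !subr0 ltW.
  have {}pi0 : 0 < p i by rewrite lt_def pi0 p0.
  rewrite -mulrBr -ln_div ?posrE//.
  rewrite -[leRHS](mulVKf (lt0r_neq0 pi0)) ler_pM2l// mulrBr mulVf ?gt_eqF//.
  rewrite (mulrC _ (q i)).
  have := @le_ln1Dx R (q i / p i - 1); rewrite subrKC; apply.
  by rewrite ltrBrDl subrr divr_gt0.
have : \sum_i (p i * ln (q i) - p i * ln (p i)) <= \sum_i (q i - p i).
  exact: ler_sum.
rewrite !sumrB p1.
have -> : \sum_i p i * - ln (q i) = - \sum_i p i * ln (q i).
  by rewrite -sumrN; apply: eq_bigr => i _; rewrite mulrN.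
lra.
Qed.

Lemma ln_prod (R : realType) (I : Type) (s : seq I) (f : I -> R) :
  (forall i, 0 < f i) -> ln (\prod_(i <- s) f i) = \sum_(i <- s) ln (f i).
Proof.
move=> f0; elim: s => [|i s ih]; first by rewrite !big_nil ln1.
by rewrite !big_cons lnM ?posrE// ?ih// prodr_gt0.
Qed.

Section code_distribution.
Context (R : realType) (I : finType) (e : R).
Hypotheses (I_gt0 : (0 < #|I|)%N) (e_gt0 : 0 < e) (e_lt1 : e < 1).

(* The letter [a] is kept with probability [1 - e] and otherwise replaced by a
   uniformly random letter. *)
Definition noise (a b : I) : R := (if b == a then 1 - e else 0) + e / #|I|%:R.

Let cardI_gt0 : 0 < #|I|%:R :> R. Proof. by rewrite ltr0n. Qed.

Let error_gt0 : 0 < e / #|I|%:R. Proof. exact: divr_gt0. Qed.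

Lemma noise_gt0 a b : 0 < noise a b.
Proof.
by rewrite /noise ltr_wpDl//; case: ifP => // _; rewrite subr_ge0 ltW.
Qed.

Lemma sum_noise a : \sum_b noise a b = 1.
Proof.
rewrite big_split/= -big_mkcond/= big_pred1_eq sumr_const.
by rewrite -[_ *+ #|_|]mulr_natr divfK ?gt_eqF// subrK.
Qed.

Lemma noise_diag a : - ln (noise a a) <= - ln (1 - e).
Proof.
rewrite lerN2 ler_ln ?posrE ?noise_gt0 ?subr_gt0//.
by rewrite /noise eqxx lerDl ltW.
Qed.

Lemma noise_le a b : - ln (noise a b) <= - ln (e / #|I|%:R).
Proof.
rewrite lerN2 ler_ln ?posrE ?noise_gt0//.
by rewrite /noise lerDr; case: ifP => // _; rewrite subr_ge0 ltW.
Qed.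

Context (k n : nat) (a : 'I_k.+1 -> nat -> I).

(** The law of the word received when one of the [k.+1] code words is drawn uniformly and its first
    [n] letters pass independently through the channel [noise]. *)
Definition code_mix (w : {ffun 'I_n -> I}) : R :=
  k.+1%:R^-1 * \sum_(i < k.+1) \prod_(j < n) noise (a i j) (w j).

Let prod_noise_gt0 i (w : {ffun 'I_n -> I}) :
  0 < \prod_(j < n) noise (a i j) (w j).
Proof. by apply: prodr_gt0 => j _; exact: noise_gt0. Qed.

Lemma code_mix_gt0 w : 0 < code_mix w.
Proof.
rewrite mulr_gt0 ?invr_gt0// big_ord_recl ltr_pwDl// sumr_ge0// => i _.
exact/ltW.
Qed.

Lemma sum_code_mix : \sum_w code_mix w = 1.
Proof.
rewrite -mulr_sumr exchange_big/=.
under eq_bigr => i _.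
  rewrite -(bigA_distr_bigA (fun j b => noise (a i (nat_of_ord j)) b)).
  under eq_bigr do rewrite sum_noise.
  rewrite big1_eq; over.
by rewrite sumr_const card_ord mulVf.
Qed.

Lemma code_mix_le1 w : code_mix w <= 1.
Proof.
rewrite -sum_code_mix (bigD1 w)//= lerDl sumr_ge0// => v _.
exact/ltW/code_mix_gt0.
Qed.

(** Dropping all but the [i]-th term of the mixture costs [ln k.+1%:R]; a correct letter then costs
    at most [- ln (1 - e)], a wrong one at most [- ln (e / #|I|%:R)]. As [err] may exceed the
    indicator of the mismatches, visits to a set can stand in for them. *)
Lemma code_mix_bound i (w : {ffun 'I_n -> I}) (err : 'I_n -> R) :
  (forall j, 0 <= err j) ->
  (forall j, w j != a i j -> err j = 1) ->
  - ln (code_mix w) <=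
    ln k.+1%:R + \sum_(j < n) (- ln (1 - e) + - ln (e / #|I|%:R) * err j).
Proof.
move=> err0 err1.
have Lge0 : 0 <= - ln (e / #|I|%:R).
  rewrite oppr_ge0 ln_le0// ler_pdivrMr// mul1r (le_trans (ltW e_lt1))//.
  by rewrite ler1n.
have le1e : 0 <= - ln (1 - e) by rewrite oppr_ge0 ln_le0// gerBl ltW.
have : - ln (code_mix w) <=
    - ln (k.+1%:R^-1 * \prod_(j < n) noise (a i j) (w j)).
  rewrite lerN2 ler_ln ?posrE ?code_mix_gt0// ?mulr_gt0 ?invr_gt0//.
  rewrite ler_pM2l ?invr_gt0// (bigD1 i)//= lerDl sumr_ge0// => i' _.
  exact/ltW.
move=> /le_trans; apply.
have prod_gt0 := prod_noise_gt0 i w.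
rewrite [ln (_^-1 * _)]lnM ?posrE ?invr_gt0// lnV ?posrE// opprD opprK lerD2l.
rewrite ln_prod; last by move=> j; exact: noise_gt0.
rewrite -sumrN; apply: ler_sum => j _.
have [wa|wa] := eqVneq (w j) (a i j).
  by rewrite wa (le_trans (noise_diag _))// lerDl mulr_ge0.
by rewrite err1// mulr1 (le_trans (noise_le _ _))// lerDr.
Qed.

End code_distribution.

(** * Integrals of weighted indicators over a set of full measure *)

Lemma measure_setI_full d (X : measurableType d) (R : realType)
    (mu : probability X R) (A B : set X) :
  measurable A -> measurable B -> mu A = 1%E -> mu (B `&` A) = mu B.
Proof.
move=> mA mB A1; rewrite [RHS](measureDI mu mB mA) -[LHS]add0e; congr (_ + _)%E.
apply/esym/eqP; rewrite -measure_le0.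
have <- : mu (~` A) = 0%E by rewrite probability_setC// A1 subee.
apply: le_measure; rewrite ?inE; [exact: measurableD|exact: measurableC|].
by rewrite setDE; exact: subIsetr.
Qed.

Section weighted_indicators.
Context d (X : measurableType d) (R : realType) (mu : probability X R).
Context (A : set X) (mA : measurable A) (A1 : mu A = 1%E).

Let measurable_sum_indic (I : finType) (c : I -> R) (C : I -> set X) :
  (forall i, measurable (C i)) ->
  measurable_fun A (fun y => (\sum_i c i * \1_(C i) y)%:E).
Proof.
move=> mC; apply/measurable_EFinP; apply: measurable_sum => i.
exact: measurable_funM.
Qed.

Lemma integral_sum_indic (I : finType) (c : I -> R) (C : I -> set X) :
  (forall i, 0 <= c i) -> (forall i, measurable (C i)) ->
  (\int[mu]_(y in A) (\sum_i c i * \1_(C i) y)%:E =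
   (\sum_i fine (mu (C i)) * c i)%:E)%E.
Proof.
move=> c0 mC; under eq_integral do rewrite -sumEFin.
rewrite ge0_integral_sum//; last first.
- by move=> n y _; rewrite lee_fin mulr_ge0.
- by move=> n; apply/measurable_EFinP; exact: measurable_funM.
rewrite -sumEFin; apply: eq_bigr => i _.
under eq_integral do rewrite EFinM.
rewrite ge0_integralZl ?lee_fin//; last exact/measurable_EFinP.
rewrite integral_indic// mulrC EFinM fineK ?fin_num_measure//.
by congr (_ * _)%E; exact: measure_setI_full.
Qed.

(** Integrate the pointwise bound over [A]. This turns a bound on the code length of each itinerary
    into one on the mean code length. *)
Lemma sum_measure_le (I J : finType) (c : I -> R) (C : I -> set X)
    (K : R) (b : J -> R) (B : J -> set X) :
  (forall i, 0 <= c i) -> (forall i, measurable (C i)) ->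
  0 <= K -> (forall j, 0 <= b j) -> (forall j, measurable (B j)) ->
  (forall y, A y -> \sum_i c i * \1_(C i) y <= K + \sum_j b j * \1_(B j) y) ->
  \sum_i fine (mu (C i)) * c i <= K + \sum_j fine (mu (B j)) * b j.
Proof.
move=> c0 mC K0 b0 mB le_sums.
rewrite -lee_fin EFinD -!integral_sum_indic//.
have -> : K%:E = (\int[mu]_(y in A) (cst K%:E y))%E.
  by rewrite integral_cst// -[LHS]mule1; congr (_ * _)%E.
rewrite -ge0_integralD//; last 2 first.
- by move=> y _; rewrite lee_fin sumr_ge0// => j _; rewrite mulr_ge0.
- exact: measurable_sum_indic.
apply: ge0_le_integral => //.
- by move=> y _; rewrite lee_fin sumr_ge0// => i _; rewrite mulr_ge0.
- exact: measurable_sum_indic.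
- by apply: emeasurable_funD => //; exact: measurable_sum_indic.
Qed.

End weighted_indicators.

(** * Labelled partitions and iterates of an endomorphism *)

Lemma measurable_partition_cell d (X : measurableType d) (I : finType)
    (P : I -> set X) :
  measurable_partition P ->
  exists cell : X -> I, P = fun i => cell @^-1` [set i].
Proof.
move=> [_ /trivIsetP tP cP].
have ex x : exists i, P i x.
  by have : setT x by []; rewrite -cP => -[i _ Pix]; exists i.
exists (fun x => projT1 (cid (ex x))); apply/funext => i; apply/seteqP.
split=> [x Pix|x] /=; case: cid => j /= Pjx; last by move=> <-.
apply: contrapT => /eqP ji.
by have /seteqP[/(_ x) + _] := tP j i Logic.I Logic.I ji; apply.
Qed.

Section endomorphism_lemmas.
Context d (X : measurableType d) (R : realType) (mu : probability X R).
Context (T : X -> X) (endoT : endomorphism mu T).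

Lemma measurable_iter n : measurable_fun setT (iter n T).
Proof.
elim: n => [|n ih] //=; first exact: measurable_id.
by apply: measurableT_comp => //; case: endoT.
Qed.

Lemma measurable_preimage_iter n A :
  measurable A -> measurable (iter n T @^-1` A).
Proof. by move=> mA; rewrite -[_ @^-1` _]setTI; exact: measurable_iter. Qed.

Lemma measure_preimage_iter n A :
  measurable A -> mu (iter n T @^-1` A) = mu A.
Proof.
move=> mA; elim: n => [|n ih] //; rewrite -ih.
rewrite -(endoT.2 _ (measurable_preimage_iter n mA)).
by congr (mu _); apply/funext => x /=; rewrite -iterSr.
Qed.

(** The preimages of [A] under the iterates increase and all have measure [mu A], hence so does
    their union, which is exactly invariant, as [ergodic] requires. *)
Lemma ergodic_superinvariant A : ergodic mu T -> measurable A ->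
  A `<=` T @^-1` A -> (0 < mu A)%E -> mu A = 1%E.
Proof.
move=> ergT mA AT A0.
pose F n := iter n T @^-1` A.
have mF n : measurable (F n) by exact: measurable_preimage_iter.
have mU : measurable (\bigcup_n F n) by exact: bigcupT_measurable.
have invU : T @^-1` (\bigcup_n F n) = \bigcup_n F n.
  apply/seteqP; split=> [x [n _]|x [n _ Fx]].
    by rewrite /F /= -iterSr => Fx; exists n.+1.
  by exists n => //; rewrite /F /= -iterSr; exact: AT.
have homF : {homo F : n m / (n <= m)%N >-> (n <= m)%O}.
  apply: homo_leq => // [|n]; first exact: le_trans.
  by apply/subsetPset => x; exact: AT.
have muU : mu (\bigcup_n F n) = mu A.
  apply: (cvg_unique _ (nondecreasing_cvg_mu mF mU homF)) => //.
  by apply: cvg_near_cst; apply: nearW => n; exact: measure_preimage_iter.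
by have [] := ergT _ mU invU; rewrite muU// => A0'; rewrite A0' ltxx in A0.
Qed.

End endomorphism_lemmas.

(** * Entropy of the joins *)

Section word_entropy.
Context d (X : measurableType d) (R : realType) (mu : probability X R).
Context (T : X -> X) (endoT : endomorphism mu T) (I : finType) (cell : X -> I).
Hypothesis mcell : forall i, measurable (cell @^-1` [set i]).

Definition itinerary n (y : X) : {ffun 'I_n -> I} :=
  [ffun j : 'I_n => cell (iter j T y)].

Local Notation join n :=
  (@iterated_join _ X T I (fun i => cell @^-1` [set i]) n).

Lemma iterated_joinE n : join n = fun w => itinerary n @^-1` [set w].
Proof.
apply/funext => w; apply/seteqP; split=> y /=.
  by move=> yw; apply/ffunP => j; rewrite ffunE; exact: yw.
by move=> <- j _; rewrite /= ffunE.
Qed.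

Lemma measurable_iterated_join n w : measurable (join n w).
Proof.
apply: fin_bigcap_measurable => [|j _]; first exact: finite_finset.
exact: (measurable_preimage_iter endoT).
Qed.

Lemma sum_indic_itinerary n (f : {ffun 'I_n -> I} -> R) y :
  \sum_w f w * \1_(join n w) y = f (itinerary n y).
Proof.
rewrite iterated_joinE (bigD1 (itinerary n y))//= indicE mem_set// mulr1.
rewrite big1 ?addr0// => w wy; rewrite indicE memNset ?mulr0//= => yw.
by rewrite yw eqxx in wy.
Qed.

Lemma sum_measure_iterated_join n : \sum_w fine (mu (join n w)) = 1.
Proof.
have /= := integral_sum_indic measurableT (probability_setT mu)
  (c := fun=> 1) (fun=> ler01) (@measurable_iterated_join n).
under [X in X = _ -> _]eq_integral do rewrite sum_indic_itinerary.
rewrite integral_cst// [X in (_ * X)%E](probability_setT mu) mule1 => -[->].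
by apply: eq_bigr => w _; rewrite mulr1.
Qed.

Lemma partition_entropy_join_ge0 n : 0 <= partition_entropy mu (join n).
Proof.
rewrite /partition_entropy -sumrN sumr_ge0// => w _.
rewrite -mulrN mulr_ge0 ?fine_ge0// oppr_ge0 ln_le0//.
have mw := @measurable_iterated_join n w.
by rewrite -lee_fin fineK ?fin_num_measure ?probability_le1.
Qed.

(** By Gibbs' inequality the entropy is at most the mean code length under [code_mix]. Mismatches
    with a suitable code word occur only at visits to [B], and by invariance the expected number of
    visits in [n] steps is [n] times [mu B]. *)
Lemma partition_entropy_join_le (A B : set X) (k n : nat)
    (a : 'I_k.+1 -> nat -> I) (e : R) :
  0 < e < 1 -> measurable A -> mu A = 1%E -> measurable B ->
  (forall y, A y -> exists i, forall j,
     cell (iter j T y) != a i j -> B (iter j T y)) ->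
  partition_entropy mu (join n) <= ln k.+1%:R +
    (- ln (1 - e) + fine (mu B) * - ln (e / #|I|%:R)) *+ n.
Proof.
move=> /andP[e0 e1] mA A1 mB close.
have I0 : (0 < #|I|)%N.
  by rewrite lt0n; apply/eqP => /card0_eq I0; have := I0 (a ord0 0).
have e1' : 0 <= - ln (1 - e) by rewrite oppr_ge0 ln_le0// gerBl ltW.
have L0 : 0 <= - ln (e / #|I|%:R).
  rewrite oppr_ge0 ln_le0// ler_pdivrMr ?ltr0n// mul1r (le_trans (ltW e1))//.
  by rewrite ler1n.
pose q := code_mix e a (n := n).
apply: (@le_trans _ _ (\sum_w fine (mu (join n w)) * - ln (q w))).
  apply: gibbs_inequality => [w|w||]; first exact: fine_ge0.
  - exact: code_mix_gt0.
  - exact: sum_measure_iterated_join.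
  - by rewrite sum_code_mix.
apply: le_trans.
  (* The constant pays for the choice of a code word and for [n] correct letters; each visit to [B]
     is charged as an error. *)
  apply: (@sum_measure_le _ _ _ mu A mA A1 _ 'I_n _ _
    (ln k.+1%:R + (- ln (1 - e)) *+ n)
    (fun=> - ln (e / #|I|%:R)) (fun j => iter j T @^-1` B)) => //.
  - by move=> w; rewrite oppr_ge0 ln_le0// code_mix_le1.
  - exact: measurable_iterated_join.
  - by rewrite addr_ge0 ?mulrn_wge0// ln_ge0// ler1n.
  - by move=> j; exact: (measurable_preimage_iter endoT).
  move=> y /close[i iy].
  rewrite (sum_indic_itinerary (fun w => - ln (q w))).
  have := @code_mix_bound R I e I0 e0 e1 k n a i (itinerary n y)
    (fun j => \1_(iter j T @^-1` B) y) => /(_ _ _)/le_trans; apply => //.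
    by move=> j; rewrite ffunE => /iy By; rewrite indicE mem_set.
  by rewrite big_split/= sumr_const card_ord addrA.
rewrite -addrA lerD2l mulrnDl lerD2l.
rewrite (eq_bigr (fun=> fine (mu B) * - ln (e / #|I|%:R))).
  by rewrite sumr_const card_ord.
by move=> j _; congr (fine _ * _); exact: measure_preimage_iter.
Qed.

End word_entropy.

(* A maximal family of points of [A] whose sections are pairwise disjoint has
   at most 1 / c members, and maximality is the conclusion. *)
Lemma finite_intersecting_cover d (X : measurableType d) (R : realType)
    (mu : probability X R) (A : set X) (G : X -> set X) (c : R) :
  0 < c -> (forall x, A x -> measurable (G x)) ->
  (forall x, A x -> (c%:E <= mu (G x))%E) ->
  exists s : seq X, {in s, forall x, A x} /\
    forall y, A y -> exists2 x, x \in s & G x `&` G y !=set0.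
Proof.
move=> c0 mG cG; apply: contrapT => no_cover.
pose U (s : seq X) := [set y | exists2 x, x \in s & G x y].
(* Without a finite cover, a point whose section misses all earlier ones can always be added, and
   each addition gains mass [c]. *)
have step n : exists s : seq X, [/\ {in s, forall x, A x}, measurable (U s) &
    ((n%:R * c)%:E <= mu (U s))%E].
  elim: n => [|n [s [sA mU nU]]].
    exists [::]; split => //; last by rewrite mul0r.
    rewrite (_ : U _ = set0); first exact: measurable0.
    by apply/seteqP; split => // x [].
  have : ~ forall y, A y -> exists2 x, x \in s & G x `&` G y !=set0.
    by move=> sc; apply: no_cover; exists s.
  move=> /existsNP[y /not_implyP[Ay yfar]].
  have Ucons : U (y :: s) = U s `|` G y.
    apply/seteqP; split=> z.
      by move=> [x]; rewrite inE => /predU1P[->|xs] Gz; [right|left; exists x].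
    by move=> [[x xs Gz]|Gz]; [exists x; rewrite // inE xs orbT|
      exists y; rewrite // mem_head].
  have UG0 : U s `&` G y = set0.
    apply/seteqP; split=> // z [[x xs Gxz] Gyz]; apply: yfar.
    by exists x => //; exists z.
  exists (y :: s); split.
  - by move=> x; rewrite inE => /predU1P[->|/sA].
  - by rewrite Ucons; apply: measurableU => //; exact: mG.
  - rewrite Ucons measureU//; last exact: mG.
    by rewrite -natr1 mulrDl mul1r EFinD leeD// cG.
(* More than [1 / c] disjoint sections would exceed the total mass 1. *)
have [s [_ mU]] := step (Num.truncn c^-1).+1.
move=> /le_trans/(_ (probability_le1 mu mU)).
rewrite lee_fin leNgt => /negP; apply.
by rewrite -ltr_pdivrMr// mul1r truncnS_gt.
Qed.

(** * Metric balls, the support and continuity sets *)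

Section metric_lemmas.
Context d (R : realType) (X : measurableMetricType d R).

Lemma mdistC (x y : X) : mdist x y = mdist y x.
Proof.
apply/eqP; rewrite eq_le; apply/andP; split; rewrite leNgt; apply/negP => lt_xy.
- have : ball y (mdist x y) x by rewrite ballEmdist.
  by move/ball_sym; rewrite ballEmdist/= ltxx.
- have : ball x (mdist y x) y by rewrite ballEmdist.
  by move/ball_sym; rewrite ballEmdist/= ltxx.
Qed.

Lemma open_metric_ball (x : X) r : open (ball x r).
Proof.
rewrite openE => y; rewrite ballEmdist/= => xy.
apply/nbhs_ballP; exists (r - mdist x y); first by rewrite /= subr_gt0.
move=> z; rewrite !ballEmdist/= ltrBrDl; exact/le_lt_trans/metric_triangle.
Qed.

Hypothesis borel_sub : <<s @open X >> `<=` d.-measurable.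

Lemma open_measurable_borel (U : set X) : open U -> measurable U.
Proof. by move=> oU; apply: borel_sub; exact: sub_sigma_algebra. Qed.

Lemma measurable_metric_ball (x : X) r : measurable (ball x r).
Proof. exact/open_measurable_borel/open_metric_ball. Qed.

Context (mu : probability X R).

Lemma measurable_support : measurable (support_of mu).
Proof.
rewrite -[X in measurable X]setCK; apply/measurableC/open_measurable_borel.
rewrite openE => x /existsNP[e /not_implyP[e0 /negP]].
rewrite lt0e measure_ge0 andbT negbK => /eqP xe0.
apply/nbhs_ballP; exists (e / 2); first by rewrite /= divr_gt0.
move=> y xy /(_ (e / 2)); rewrite divr_gt0// => /(_ isT).
apply/negP; rewrite -leNgt -xe0.
apply: le_measure; rewrite ?inE; [exact: measurable_metric_ball..|].
by move=> z yz; rewrite [e]splitr; exact: ball_triangle xy yz.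
Qed.

(** Balls of radius [r / 2] and mass at least [1 / (n + 1)] have centres within [r] of finitely many
    points, since two such balls that meet have [r]-close centres. Each point of the support
    qualifies for some [n]. *)
Lemma support_separable r : 0 < r -> exists s : nat -> seq X,
  forall x, support_of mu x -> exists n, exists2 q, q \in s n & ball q r x.
Proof.
move=> r0; have r20 : 0 < r / 2 by rewrite divr_gt0.
have fin n := @finite_intersecting_cover _ _ _ mu
  [set x | (n.+1%:R^-1%:E <= mu (ball x (r / 2)%R))%E] (fun x => ball x (r / 2))
  n.+1%:R^-1 (ltac:(by [])) (fun x _ => measurable_metric_ball x (r / 2))
  (fun x => id).
have [s sP] := choice fin.
exists s => x /(_ _ r20) x0.
have [n nx] : exists n, (n.+1%:R^-1%:E <= mu (ball x (r / 2)%R))%E.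
  have fin_x : mu (ball x (r / 2)) \is a fin_num.
    exact/fin_num_measure/measurable_metric_ball.
  move: x0; rewrite -(fineK fin_x) lte_fin => x0.
  have [n] := ltr_add_invr x0.
  by rewrite add0r => /ltW xn; exists n; rewrite lee_fin.
have [q qs [z [qz xz]]] := (sP n).2 x nx.
exists n, q => //; rewrite [r]splitr.
by apply: ball_triangle qz _; exact: ball_sym.
Qed.

(* [D] is a measurable stand-in for the set of [e]-close pairs, which need not
   be product measurable since [X] need not be separable. *)
Lemma measurable_close_pairs e : 0 < e -> exists D : set (X * X),
  [/\ measurable D,
   forall x y, support_of mu x -> mdist x y < e -> D (x, y) &
   forall x y, D (x, y) -> mdist x y < 3%:R * e].
Proof.
move=> e0; have [s sP] := support_separable e0.
(* If [x] is [e]-close to a centre [q] and to [y], then [y] is [2 e]-close to [q]; conversely, a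
   pair in such a rectangle is at distance below [e + 2 e]. *)
exists (\bigcup_n \bigcup_(q in [set` s n]) (ball q e `*` ball q (e + e))).
split=> [|x y /sP[n [q qs qx]] xy|x y [n _ [q qs [/= qx qy]]]].
- apply: bigcupT_measurable => n; apply: fin_bigcup_measurable => [|q _].
    exact: finite_seq.
  by apply: measurableX; exact: measurable_metric_ball.
- exists n => //; exists q => //; split => //=.
  by apply: ball_triangle qx _; rewrite ballEmdist.
- have := ball_triangle (ball_sym qx) qy.
  by rewrite ballEmdist/= => /lt_le_trans; apply; rewrite !mulrDl !mul1r addrA.
Qed.

(** [B n] gathers the points at distance below [1 / (n + 1)] from the complement of every cell. A
    point of all [B n] lies on the boundary of its own cell, so these sets decrease to a null set;
    off [B n], the ball of that radius stays in one cell. *)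
Lemma continuity_cells_radius (I : finType) (cell : X -> I) (eta : R) :
  (forall i, continuity_set mu (cell @^-1` [set i])) -> 0 < eta ->
  exists r (B : set X), [/\ 0 < r, measurable B, (mu B < eta%:E)%E &
    forall y z, ~ B y -> mdist y z < r -> cell z = cell y].
Proof.
move=> contP eta0.
pose V i r : set X := \bigcup_(z in [set z | cell z != i]) ball z r.
pose B n : set X := \bigcap_(i in [set: I]) V i n.+1%:R^-1.
have mB n : measurable (B n).
  apply: fin_bigcap_measurable => [|i _]; first exact: finite_finset.
  by apply/open_measurable_borel/bigcup_open => z _; exact: open_metric_ball.
have mcap : measurable (\bigcap_n B n) by exact: bigcapT_measurable.
have homB : {homo B : n m / (n <= m)%N >-> (m <= n)%O}.
  move=> n m nm; apply/subsetPset => y Bm i _; have [z zi zy] := Bm i Logic.I.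
  by exists z => //; apply: le_ball zy; rewrite lef_pV2 ?posrE// ler_nat ltnS.
have cap0 : mu (\bigcap_n B n) = 0%E.
  apply/(negligibleP mu mcap).
  apply: (@negligibleS _ _ _ mu (\big[setU/set0]_i
    (closure (cell @^-1` [set i]) `\` (cell @^-1` [set i])°))).
    move=> y By; rewrite (bigD1 (cell y))//=; left; split.
      exact: subset_closure.
    move=> /nbhs_ballP[e /= e0 ey].
    have [n] := ltr_add_invr e0; rewrite add0r => /ltW ne.
    have [z /eqP zy zn] := By n Logic.I (cell y) Logic.I.
    apply: zy; apply: ey; apply: le_ball ne _ _; exact: ball_sym.
  elim/big_ind: _ => [|? ?|i _]; [exact: negligible_set0|exact: negligibleU|].
  exists (closure (cell @^-1` [set i]) `\` (cell @^-1` [set i])°); split => //.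
  - apply: measurableD; last exact/open_measurable_borel/open_interior.
    rewrite -[closure _]setCK; apply/measurableC/open_measurable_borel.
    exact/closed_openC/closed_closure.
  - exact: (contP i).2.
have muB0 : (mu (B 0%N) < +oo)%E by rewrite ltey_eq fin_num_measure.
have := nonincreasing_cvg_mu muB0 mB mcap homB; rewrite [X in _ --> X]cap0.
have eta0' : (0 < eta%:E :> \bar R)%E by rewrite lte_fin.
move=> /(_ _ (open_ereal_lt' eta0'))[n _ sub_n].
have Bn : (mu (B n) < eta%:E)%E by exact: (sub_n n (leqnn n)).
exists n.+1%:R^-1, (B n); split => // y z nBy yz.
have [i ni] : exists i, ~ V i n.+1%:R^-1 y.
  by apply: contrapT => /forallNP nV; apply: nBy => i _; exact: contrapT (nV i).
have cell_i w : mdist y w < n.+1%:R^-1 -> cell w = i.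
  move=> yw; apply: contrapT => /eqP wi; apply: ni; exists w => //.
  by apply: ball_sym; rewrite ballEmdist.
by rewrite !cell_i// mdistxx.
Qed.

End metric_lemmas.

(** * Pairs of orbits that stay close forever *)

(** The section of [G] at [x] lies in the preimage under [T] of the section at [T x], so the
    superlevel sets of the section measure are superinvariant; ergodicity makes a non-null one
    full. *)
Lemma ae_close_orbits d (X : measurableType d) (R : realType)
    (mu : probability X R) (T : X -> X) (G : set (X * X)) :
  endomorphism mu T -> ergodic mu T -> measurable G ->
  (forall x y, G (x, y) -> G (T x, T y)) -> (mu \x mu)%E G != 0%E ->
  exists2 c : R, 0 < c &
    measurable [set x | (c%:E <= mu (xsection G x))%E] /\
    mu [set x | (c%:E <= mu (xsection G x))%E] = 1%E.
Proof.
move=> endoT ergT mG GT G0.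
have mf : measurable_fun setT (mu \o xsection G).
  exact: measurable_fun_xsection.
pose A n := [set x | (n.+1%:R^-1%:E <= mu (xsection G x))%E].
have mA n : measurable (A n).
  rewrite -[A n]setTI; exact: emeasurable_fun_c_infty.
(* Otherwise the section measure vanishes almost everywhere, and with it its integral, the product
   measure of [G]. *)
have [n An] : exists n, mu (A n) != 0%E.
  apply: contrapT => /forallNP A0; move/eqP: G0; apply.
  rewrite /product_measure1; have [_ +] := ae_eq_integral_abs mu measurableT mf.
  under [X in (_ -> X = _) -> _]eq_integral do rewrite gee0_abs//.
  apply.
  apply: (@negligibleS _ _ _ mu (\bigcup_n A n)).
    move=> x /not_implyP[_ /= /eqP fx0].
    have fin_x : mu (xsection G x) \is a fin_num.
      exact/fin_num_measure/measurable_xsection.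
    have : (0 < mu (xsection G x))%E by rewrite lt0e fx0/=.
    rewrite -(fineK fin_x) lte_fin => /ltr_add_invr[k].
    rewrite add0r => /ltW xk; exists k => //.
    by rewrite /A /= -(fineK fin_x) lee_fin.
  apply: negligible_bigcup => n; apply/negligibleP => //.
  by apply/eqP; apply: contrapT => An; apply: (A0 n); exact/negP.
exists n.+1%:R^-1 => //; split; first exact: mA.
apply: (ergodic_superinvariant endoT ergT (mA n)); last first.
  by rewrite lt0e An measure_ge0.
move=> x /le_trans; apply.
have mGx y : measurable (xsection G y) by exact: measurable_xsection.
rewrite -(endoT.2 _ (mGx (T x))).
apply: le_measure; rewrite ?inE//.
  exact: (measurable_preimage_iter endoT 1).
by move=> y /xsectionP Gxy; apply/xsectionP; exact: GT.
Qed.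

(** * Zero entropy in the absence of sensitivity *)

Section insensitive.
Context d (R : realType) (X : measurableMetricType d R) (mu : probability X R).
Context (T : X -> X).
Hypotheses (borel_sub : <<s @open X >> `<=` d.-measurable)
  (full_supp : mu (support_of mu) = 1%E) (endoT : endomorphism mu T)
  (ergT : ergodic mu T) (nsens : ~ symmetrically_sensitive mu T).

(** If the sections at [x] and [y] share a point [z], both orbits follow that of [z], hence each
    other. *)
Lemma insensitive_total_boundedness r : 0 < r ->
  exists (A : set X) (s : seq X), [/\ measurable A, mu A = 1%E &
    forall y, A y -> exists2 x, x \in s &
      forall n, mdist (iter n T y) (iter n T x) < r].
Proof.
(* The set [D] loses a factor 3 and the passage through [z] a factor 2, hence [r / 6]. *)
move=> r0; have e0 : 0 < r / 6 by rewrite divr_gt0.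
have [D [mD closeD Dclose]] := measurable_close_pairs borel_sub mu e0.
pose TT n (z : X * X) := (iter n T z.1, iter n T z.2).
pose G := \bigcap_n (TT n @^-1` D).
have mG : measurable G.
  apply: bigcapT_measurable => n; rewrite -[_ @^-1` _]setTI.
  apply: measurable_fun_pair => //; apply: measurableT_comp => //;
    exact: (measurable_iter endoT).
have GT x y : G (x, y) -> G (T x, T y).
  by move=> Gxy n _; have := Gxy n.+1 Logic.I; rewrite /TT /= -!iterSr.
have G0 : (mu \x mu)%E G != 0%E.
  apply/eqP => G0; apply: nsens; exists (r / 6) => //.
  (* [closeD] applies only while the first point is in the support, so the null set of orbits that
     ever leave it is split off. *)
  pose N := \bigcup_n (iter n T @^-1` (~` support_of mu)).
  have mS := measurable_support borel_sub mu.
  have mTN n : measurable (iter n T @^-1` (~` support_of mu)).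
    exact/(measurable_preimage_iter endoT)/measurableC.
  have mN : measurable N by exact: bigcupT_measurable.
  have N0 : mu N = 0%E.
    apply/negligibleP => //; apply: negligible_bigcup => n.
    apply/negligibleP => //.
    apply: etrans (measure_preimage_iter endoT n (measurableC mS)) _.
    by rewrite probability_setC// full_supp subee.
  apply: (@negligibleS _ _ _ (mu \x mu)%E (G `|` (N `*` setT))).
    move=> [x y] /forallNP xy.
    have [Nx|Nx] := pselect (N x); [by right|left => n _].
    apply: closeD; last by rewrite ltNge; exact/negP/xy.
    by apply: contrapT => nS; apply: Nx; exists n.
  apply: negligibleU; first exact/negligibleP.
  apply/negligibleP; first exact: measurableX.
  apply: etrans (product_measure1E mu mu mN measurableT) _.
  by rewrite [X in (X * _)%E]N0 mul0e.
have [c c0 [mA A1]] := ae_close_orbits endoT ergT mG GT G0.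
have [s [_ sP]] := @finite_intersecting_cover _ _ _ mu
  [set x | (c%:E <= mu (xsection G x))%E] (xsection G) c c0
  (fun x _ => measurable_xsection x mG) (fun x => id).
exists [set x | (c%:E <= mu (xsection G x))%E], s; split => // y /sP[x xs].
move=> [z [/xsectionP Gxz /xsectionP Gyz]]; exists x => // n.
have := Dclose _ _ (Gxz n Logic.I); have := Dclose _ _ (Gyz n Logic.I) => /=.
rewrite [X in _ -> X < _ -> _]mdistC => yz zx.
by have := metric_triangle (iter n T y) (iter n T z) (iter n T x); lra.
Qed.

Lemma insensitive_entropy_le (I : finType) (cell : X -> I) (eta : R) :
  (forall i, continuity_set mu (cell @^-1` [set i])) -> 0 < eta ->
  exists K, forall n, partition_entropy mu
    (@iterated_join _ X T I (fun i => cell @^-1` [set i]) n) <= K + eta *+ n.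
Proof.
move=> contP eta0.
(* Makes [- ln (1 - e)] equal to [eta / 2]; the other half of [eta] pays for the errors, through the
   smallness of [mu B]. *)
pose e := 1 - expR (- (eta / 2)).
have e01 : 0 < e < 1.
  rewrite subr_gt0 expR_lt1 oppr_lt0 divr_gt0//=.
  by rewrite gtrBl expR_gt0.
pose L := - ln (e / #|I|%:R).
(* A positive majorant of [L], by which [eta / 2] can be divided. *)
have Lpos : 0 < `|L| + 1 by rewrite ltr_wpDl.
have [r [B [r0 mB Bsmall cellB]]] :=
  continuity_cells_radius borel_sub contP
    (divr_gt0 (divr_gt0 eta0 (ltr0Sn R 1)) Lpos).
have [A [s [mA A1 close]]] := insensitive_total_boundedness r0.
have s0 : (0 < size s)%N.
  have /set0P[y /close[x]] : A != set0.
    apply/eqP => A0; move: A1; rewrite A0 measure0 => /esym/eqP.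
    by rewrite onee_eq0.
  by case: (s).
have [x0 _] : exists x0, x0 \in s.
  by case: (s) s0 => // x0 s' _; exists x0; rewrite mem_head.
pose a (i : 'I_(size s).-1.+1) j := cell (iter j T (nth x0 s i)).
exists (ln (size s).-1.+1%:R) => n.
have mcell i : measurable (cell @^-1` [set i]) by exact: (contP i).1.
have := @partition_entropy_join_le _ X R mu T endoT I cell mcell A B _ n a e
  e01 mA A1 mB.
move=> /(_ _)/le_trans; apply.
  move=> y /close[x xs xy].
  have xs' : (index x s < (size s).-1.+1)%N by rewrite prednK// index_mem.
  exists (Ordinal xs') => j; rewrite /a /= nth_index// => ne.
  apply: contrapT => nB.
  by move: ne; rewrite (cellB _ _ nB (xy j)) eqxx.
rewrite lerD2l lerMn2r; apply/orP; right.
have -> : - ln (1 - e) = eta / 2 by rewrite /e opprB subrKC expRK opprK.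
rewrite [leRHS]splitr lerD2l -/L.
apply: (@le_trans _ _ (fine (mu B) * (`|L| + 1))).
  by rewrite ler_wpM2l ?fine_ge0// (le_trans (ler_norm L))// lerDl.
rewrite -ler_pdivlMr// -lee_fin fineK ?fin_num_measure//; exact: ltW.
Qed.

(** As [ks_entropy] is a [limn], convergence to 0 itself is proved: dividing by [n] kills the
    constant and leaves an arbitrarily small rate. *)
Lemma insensitive_ks_entropy0 (I : finType) (cell : X -> I) :
  (forall i, continuity_set mu (cell @^-1` [set i])) ->
  ks_entropy mu T (fun i => cell @^-1` [set i]) = 0.
Proof.
move=> contP; apply/cvg_lim => //; apply/cvgrPdist_le => eta eta0.
have [K HK] := insensitive_entropy_le contP (divr_gt0 eta0 (ltr0Sn R 1)).
have e20 : 0 < eta / 2 by rewrite divr_gt0.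
near=> n.
have n0 : 0 < n%:R :> R by rewrite ltr0n; near: n; exists 1%N.
rewrite sub0r normrN ger0_norm; last first.
  rewrite divr_ge0// partition_entropy_join_ge0// => i; exact: (contP i).1.
rewrite ler_pdivrMr//; apply: le_trans (HK n) _.
(* One half of [eta] covers the rate, the other absorbs [K] for large [n]. *)
rewrite -[_ / 2 *+ n]mulr_natr {2}[eta]splitr mulrDl lerD2r.
rewrite -ler_pdivrMl//; near: n; exact: nbhs_infty_ger.
Unshelve. all: by end_near. Qed.

End insensitive.

Theorem theorem3p1 (d : measure_display) (R : realType)
    (X : measurableMetricType d R) (mu : probability X R)
    (T : X -> X) (l : nat) (P : 'I_l -> set X)
    (lebesgueX : lebesgue_space mu)
    (borel_sub : <<s @open X >> `<=` d.-measurable)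
    (full_supp : mu (support_of mu) = 1%E)
    (supp_not_point : ~ exists x : X, support_of mu = [set x])
    (endoT : endomorphism mu T)
    (ergT : ergodic mu T)
    (partP : measurable_partition P)
    (contP : forall i, continuity_set mu (P i))
    (entropy_gt0 : 0 < ks_entropy mu T P) :
  symmetrically_sensitive mu T.
Proof.
have [cell Pcell] := measurable_partition_cell partP; subst P.
apply: contrapT => nsens; move: entropy_gt0.
have -> // := insensitive_ks_entropy0 borel_sub full_supp endoT ergT nsens.
by rewrite ltxx.
Qed.
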